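(* For integers $m,n>2$ and $l>0$, \begin{align*} \zeta_{H_{m,n,l}}(u)^{-1}=&-4u^{2m+2n+2l}+u^{2m+2n}+4u^{2m+n+2l}+4u^{m+2n+2l}-2u^{2m+n}-2u^{m+2n}\\ &-4u^{m+n+2l}+4u^{m+n}+u^{2n}+u^{2m}-2u^{n}-2u^{m}+1. \end{align*}
   Context: For $m,n>2$ and $l>0$, the handcuff graph $H_{m,n,l}$ consists of two vertex-disjoint cycles $C_m$ and $C_n$ together with a path of $l$ edges joining a vertex of $C_m$ to a vertex of $C_n$, internally disjoint from both cycles. For a finite connected graph $G$ with vertex set $V$, edge set $E$ and no vertex of degree $1$, let $r=|E|-|V|+1$, $\mathcal{A}$ the adjacency matrix, $\mathcal{Q}=D-I$ with $D$ the diagonal degree matrix; the reciprocal Ihara zeta function is $\zeta_G(u)^{-1}=(1-u^2)^{r-1}\det(I-\mathcal{A}u+\mathcal{Q}u^2)$. *)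

(* Defs.v *)
From HB Require Import structures.
From mathcomp Require Import all_boot all_order all_algebra.
Set Implicit Arguments. Unset Strict Implicit. Unset Printing Implicit Defensive.
Import Order.TTheory GRing.Theory Num.Theory.
Local Open Scope ring_scope.

(* A finite simple graph on vertex set 'I_N is given by an adjacency relation
   (assumed symmetric and irreflexive). *)

Definition gdeg (N : nat) (adj : rel 'I_N) (i : 'I_N) : nat :=
  #|[set j | adj i j]|.

Definition gedges (N : nat) (adj : rel 'I_N) : nat :=
  ((\sum_(i < N) gdeg adj i) %/ 2)%N.

Definition grank (N : nat) (adj : rel 'I_N) : nat :=
  (gedges adj + 1 - N)%N.

Definition adjmx (N : nat) (adj : rel 'I_N) : 'M[int]_N :=
  \matrix_(i, j) (adj i j)%:R.

Definition Qmx (N : nat) (adj : rel 'I_N) : 'M[int]_N :=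
  \matrix_(i, j) ((i == j)%:R * ((gdeg adj i)%:R - 1)).

Definition ihara_recip (N : nat) (adj : rel 'I_N) : {poly int} :=
  (1 - 'X^2) ^+ (grank adj).-1 *
  \det (\matrix_(i, j)
          (((i == j)%:R)%:P - (adjmx adj i j)%:P * 'X
           + (Qmx adj i j)%:P * 'X^2) : 'M[{poly int}]_N).

(* Handcuff graph H_{m,n,l}: vertices 0..m-1 form the cycle C_m,
   vertices m..m+n-1 form the cycle C_n, and vertices m+n..m+n+l-2
   are the internal vertices of the path of l edges
   0 = p_0 - p_1 - ... - p_l = m, with p_k = m+n+k-1 for 0<k<l.
   Total number of vertices: m+n+l-1. *)
Definition hc_pathv (m n l k : nat) : nat :=
  if k == 0%N then 0%N else if k == l then m else (m + n + k - 1)%N.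

Definition hc_dedge (m n l : nat) (i j : nat) : bool :=
  [|| (i < m)%N && (j == (i.+1 %% m)%N),
      (m <= i < m + n)%N && (j == m + ((i - m).+1 %% n))%N
    | [exists k : 'I_l, (i == hc_pathv m n l k) && (j == hc_pathv m n l k.+1)]].

Definition handcuff_adj (m n l : nat) : rel 'I_(m + n + l - 1) :=
  fun i j => hc_dedge m n l i j || hc_dedge m n l j i.
Arguments handcuff_adj m n l : clear implicits.

(* Main.v *)
(** With a = u^m, b = u^n, c = u^l, the claimed polynomial factors as
    (1 - a)(1 - b)((1 - a)(1 - b) - 4 a b c^2).  Over the fraction field of Z[u],
    the matrix I - Au + Qu^2 is triangularised by eliminating the vertices in
    decreasing order: multiplication on the right by a lower unitriangular matrix
    makes it upper triangular.  Column k of the multiplier is 1 at k, vanishes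
    below k and is annihilated by all rows beyond k; since
    (1 + u^2) f(j) = u (f(j-1) + f(j+1)) has the solutions u^j and u^-j, these
    columns are explicit on each cycle and on the path.  The pivot at a
    vertex of degree 2 at distance J from the far end of its segment is
    (1 - u^(2J+2)) / (1 - u^(2J)), so these pivots telescope along each segment,
    and only the pivots at the two vertices of degree 3 have to be computed. *)

Require Import Defs.
From HB Require Import structures.
From mathcomp Require Import all_boot all_order all_algebra.
From mathcomp Require Import zify ring.
Import Order.TTheory GRing.Theory Num.Theory.
Local Open Scope ring_scope.

(* Vertex k of the cycle s, ..., s + L - 1, with k = L wrapping around to s. *)
Definition cycv (s L k : nat) : nat := if k == L then s else (s + k)%N.

Definition hc_nbrs (m n l i : nat) : seq nat :=
  if i == 0%N then [:: 1; m.-1; hc_pathv m n l 1]%N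
  else if (i < m)%N then [:: i.-1; cycv 0 m i.+1]
  else if i == m then [:: m.+1; (m + n).-1; hc_pathv m n l l.-1]%N
  else if (i < m + n)%N then [:: i.-1; cycv m n (i - m).+1]
  else let k := (i.+1 - (m + n))%N in
       [:: hc_pathv m n l k.-1; hc_pathv m n l k.+1].

Ltac split_ifs :=
  repeat match goal with
  | |- context [if ?x == ?y then _ else _] =>
      case: (x =P y) => ?; try (exfalso; lia)
  | |- context [if (?x <= ?y)%N then _ else _] =>
      case: (leqP x y) => ?; try (exfalso; lia)
  end.

Lemma sum_ord_eq (N k : nat) : (k < N)%N -> (\sum_(i < N) (i == k :> nat) = 1)%N.
Proof.
move=> hk; rewrite (bigD1 (Ordinal hk)) //= eqxx big1 // => i.
by rewrite -val_eqE => /negPf ->.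
Qed.

(** * Adjacency, degrees and rank of the handcuff graph *)

Section Graph.
Variables (m n l : nat).
Hypotheses (hm : (2 < m)%N) (hn : (2 < n)%N) (hl : (0 < l)%N).
Local Notation N := (m + n + l - 1)%N.

(** Only the first and the last path edge touch a cycle, and every other one joins consecutive
    numbers. This removes the existential, so that [lia] can decide the cases; for [l = 1] the first
    two disjuncts describe the same edge. *)
Lemma hc_path_dedgeE (i j : nat) :
  [exists k : 'I_l, (i == hc_pathv m n l k) && (j == hc_pathv m n l k.+1)] =
  [|| (i == 0%N) && (j == hc_pathv m n l 1),
      (j == m) && (i == hc_pathv m n l l.-1)
    | [&& m + n <= i, j == i.+1 & j < N]%N].
Proof.
apply/existsP/idP => [[[k /= hk]]|].
  rewrite /hc_pathv; repeat case: ifP; lia.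
case/or3P => [/andP[/eqP -> /eqP ->]|/andP[/eqP -> /eqP ->]|/and3P[h1 /eqP -> h2]].
- by exists (Ordinal hl); rewrite /= eqxx.
- have h : (l.-1 < l)%N by lia.
  by exists (Ordinal h); rewrite /= eqxx prednK // /hc_pathv eqxx; case: ifP; lia.
have h : (i.+1 - (m + n) < l)%N by lia.
exists (Ordinal h); rewrite /= /hc_pathv; repeat case: ifP; lia.
Qed.

Lemma cycle_stepE (L i : nat) : (i < L)%N -> (i.+1 %% L)%N = cycv 0 L i.+1.
Proof.
rewrite /cycv => h; case: eqP => [->|h']; first by rewrite modnn.
by rewrite modn_small; lia.
Qed.

Lemma hc_dedgeE (i j : nat) : hc_dedge m n l i j =
  [|| (i < m)%N && (j == cycv 0 m i.+1),
      (m <= i < m + n)%N && (j == cycv m n (i - m).+1),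
      (i == 0%N) && (j == hc_pathv m n l 1),
      (j == m) && (i == hc_pathv m n l l.-1)
    | [&& m + n <= i, j == i.+1 & j < N]%N].
Proof.
rewrite /hc_dedge hc_path_dedgeE; congr (_ || (_ || _)).
  by apply: andb_id2l => h; rewrite cycle_stepE.
apply: andb_id2l => h; rewrite cycle_stepE; last by lia.
by rewrite /cycv; case: ifP; lia.
Qed.

Lemma hc_dedge_nbr (i j : nat) : (i < N)%N -> (j < N)%N ->
  hc_dedge m n l i j -> (j \in hc_nbrs m n l i) && (i \in hc_nbrs m n l j).
Proof.
rewrite hc_dedgeE => hi hj.
case/or4P => [||/andP[]|/orP[]/andP[]]; rewrite /hc_nbrs /cycv /hc_pathv.
- case/andP=> h; case: ifP => h2 /eqP ej; apply/andP; split; subst j;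
  (split_ifs; rewrite ?inE; lia).
- case/andP=> h; case: ifP => h2 /eqP ej; apply/andP; split; subst j;
  (split_ifs; rewrite ?inE; lia).
- move=> /eqP -> {i hi}; case: ifP => h1 //; case: ifP => h2 /eqP ej; apply/andP; split; subst j;
  (split_ifs; rewrite ?inE; lia).
- move=> /eqP -> {j hj}; case: ifP => h1; [|case: ifP => h2] => /eqP ej; apply/andP; split; subst i;
  (split_ifs; rewrite ?inE; lia).
move=> h /andP[/eqP ej hj']; apply/andP; split; subst j;
  (split_ifs; rewrite ?inE; lia).
Qed.

Lemma hc_dedge_cycle1 (i : nat) : (i < m)%N -> hc_dedge m n l i (cycv 0 m i.+1).
Proof. by move=> h; rewrite /hc_dedge h -cycle_stepE // eqxx. Qed.

Lemma hc_dedge_cycle2 (k : nat) :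
  (k < n)%N -> hc_dedge m n l (m + k) (cycv m n k.+1).
Proof.
move=> h; rewrite /hc_dedge leq_addr ltn_add2l h addKn (cycle_stepE n k h).
suff -> : (cycv m n k.+1 = m + cycv 0 n k.+1)%N by rewrite eqxx orbT.
by rewrite /cycv; case: ifP => _; rewrite ?addn0.
Qed.

Lemma hc_dedge_path (k : nat) :
  (k < l)%N -> hc_dedge m n l (hc_pathv m n l k) (hc_pathv m n l k.+1).
Proof.
move=> h; apply/or3P/Or33/existsP.
by exists (Ordinal h); rewrite /= !eqxx.
Qed.

Lemma hc_nbr_dedge (i j : nat) : (i < N)%N ->
  j \in hc_nbrs m n l i -> hc_dedge m n l i j || hc_dedge m n l j i.
Proof.
move=> hi; rewrite /hc_nbrs.
have cyc1 (k : nat) : (k < m)%N -> cycv 0 m k = k by rewrite /cycv; case: eqP; lia.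
have cyc2 (k : nat) : (k < n)%N -> cycv m n k = (m + k)%N by rewrite /cycv; case: eqP; lia.
have pathl : hc_pathv m n l l = m by rewrite /hc_pathv eqxx; case: eqP; lia.
case: eqP => [-> | i0].
  rewrite !inE => /or3P[]/eqP->.
  - by rewrite -[X in hc_dedge _ _ _ 0 X]cyc1 ?hc_dedge_cycle1; lia.
  - have := @hc_dedge_cycle1 m.-1; rewrite /cycv prednK ?eqxx; last by lia.
    by move=> ->; rewrite ?orbT //; lia.
  - by rewrite (hc_dedge_path 0).
case: ltnP => h1.
  rewrite !inE => /orP[]/eqP->; last by rewrite hc_dedge_cycle1.
  have := @hc_dedge_cycle1 i.-1; rewrite prednK ?cyc1; try lia.
case: eqP => [-> |h2].
  rewrite !inE => /or3P[]/eqP->.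
  - have := @hc_dedge_cycle2 0; rewrite cyc2; last by lia.
    by rewrite addn0 addn1 => ->; rewrite ?orbT //; lia.
  - have := @hc_dedge_cycle2 n.-1; rewrite /cycv prednK ?eqxx; last by lia.
    rewrite (_ : m + n.-1 = (m + n).-1)%N; last by lia.
    by move=> ->; rewrite ?orbT //; lia.
  - have := @hc_dedge_path l.-1; rewrite prednK // pathl => ->; last by lia.
    by rewrite orbT.
case: ltnP => h3.
  rewrite !inE => /orP[]/eqP->.
    have := @hc_dedge_cycle2 (i - m).-1; rewrite prednK ?cyc2; try lia.
    rewrite (_ : m + (i - m).-1 = i.-1)%N; last by lia.
    rewrite (_ : m + (i - m) = i)%N; last by lia.
    by move=> ->; rewrite ?orbT //; lia.
  have := @hc_dedge_cycle2 (i - m); rewrite subnKC; last by lia.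
  by move=> ->; rewrite ?orbT //; lia.
(* A path vertex is recoded by its position on the path; its two neighbours then come from the edges
   at positions [k.-1] and [k]. *)
have ei : i = hc_pathv m n l (i.+1 - (m + n)).
  by rewrite /hc_pathv; case: eqP; [lia | case: eqP; lia].
have hk : (0 < i.+1 - (m + n) < l)%N by lia.
move: (i.+1 - (m + n))%N ei hk => k -> /andP[k0 kl].
rewrite !inE => /orP[]/eqP->; last by rewrite hc_dedge_path.
have := @hc_dedge_path k.-1; rewrite prednK //.
by move=> ->; rewrite ?orbT //; lia.
Qed.

Lemma hc_adjE (i j : 'I_N) : handcuff_adj m n l i j = (val j \in hc_nbrs m n l i).
Proof.
apply/idP/idP; last exact: hc_nbr_dedge.
by case/orP => /hc_dedge_nbr - /(_ (ltn_ord _) (ltn_ord _))/andP[].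
Qed.

(** Cycle lengths above 2 matter here: the two neighbours of a vertex along its cycle are then
    distinct, so list lengths are degrees. *)
Lemma hc_nbrs_uniq (i : nat) : (i < N)%N -> uniq (hc_nbrs m n l i).
Proof.
move=> hi; rewrite /hc_nbrs /cycv /hc_pathv.
by split_ifs; rewrite /= ?inE; lia.
Qed.

Lemma hc_nbrs_lt (i : nat) : (i < N)%N -> all (fun j => j < N)%N (hc_nbrs m n l i).
Proof.
move=> hi; rewrite /hc_nbrs /cycv /hc_pathv.
by split_ifs; rewrite /= ?inE; lia.
Qed.

Lemma hc_nbrs_enum (i : 'I_N) :
  perm_eq [seq val j | j <- enum 'I_N & handcuff_adj m n l i j] (hc_nbrs m n l i).
Proof.
apply: uniq_perm.
- by rewrite map_inj_uniq; [rewrite filter_uniq // enum_uniq | exact: val_inj].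
- exact: hc_nbrs_uniq.
move=> x; apply/mapP/idP => [[j]|hx].
  by rewrite mem_filter hc_adjE => /andP[hj _] ->.
have hxN : (x < N)%N by have /allP := hc_nbrs_lt i (ltn_ord i); apply.
by exists (Ordinal hxN); rewrite // mem_filter hc_adjE hx mem_enum.
Qed.

Lemma hc_gdeg (i : 'I_N) : gdeg (handcuff_adj m n l) i = size (hc_nbrs m n l i).
Proof.
rewrite /gdeg -sum1_size -(perm_big _ (hc_nbrs_enum i)) /= big_map big_filter.
by rewrite big_enum_cond /= -sum1_card; apply: eq_bigl => j; rewrite inE.
Qed.

Lemma hc_adj_sum (R : pzRingType) (i : 'I_N) (v : nat -> R) :
  \sum_(j < N) (handcuff_adj m n l i j)%:R * v j = \sum_(j <- hc_nbrs m n l i) v j.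
Proof.
rewrite -(perm_big _ (hc_nbrs_enum i)) /= big_map big_filter big_enum_cond /=.
rewrite [RHS]big_mkcond /=; apply: eq_bigr => j _.
by case: handcuff_adj; rewrite ?mul1r ?mul0r.
Qed.

Lemma size_hc_nbrs (i : nat) : size (hc_nbrs m n l i) = (2 + (i == 0%N) + (i == m))%N.
Proof. rewrite /hc_nbrs; repeat (case: ifP => ?) => /=; lia. Qed.

(** Two vertices have degree 3 and all others degree 2, so the degree sum is [2 * N + 2] and there
    are [N + 1] edges. *)
Lemma hc_grank : grank (handcuff_adj m n l) = 2%N.
Proof.
rewrite /grank /gedges.
under eq_bigr => i _ do rewrite hc_gdeg size_hc_nbrs -addnA.
rewrite big_split big_split /= !sum_ord_eq; try lia.
rewrite sum_nat_const card_ord; lia.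
Qed.

Lemma hc_nbrs_cyc1 k :
  (0 < k < m)%N -> hc_nbrs m n l k = [:: k.-1; cycv 0 m k.+1].
Proof. by case: k => // k h; rewrite /hc_nbrs /= ifT //; lia. Qed.

Lemma hc_nbrs_cyc2 k : (0 < k < n)%N ->
  hc_nbrs m n l (m + k) = [:: (m + k.-1)%N; cycv m n k.+1].
Proof.
move=> h; rewrite /hc_nbrs ifF; last by lia.
rewrite ifF; last by lia.
rewrite ifF; last by lia.
rewrite ifT; last by lia.
rewrite addKn; congr [:: _; _]; lia.
Qed.

Lemma hc_nbrs_path k : (0 < k < l)%N ->
  hc_nbrs m n l (m + n + k - 1) = [:: hc_pathv m n l k.-1; hc_pathv m n l k.+1].
Proof.
move=> h; rewrite /hc_nbrs ifF; last by lia.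
rewrite ifF; last by lia.
rewrite ifF; last by lia.
rewrite ifF; last by lia.
by have -> : ((m + n + k - 1).+1 - (m + n) = k)%N by lia.
Qed.

(** Case analysis for row and column indices: the two branching vertices, and the vertices of degree
    2 by position on their segment. *)
Variant hc_vertex_spec : nat -> Type :=
| HcVertex0 : hc_vertex_spec 0
| HcVertexCyc1 k of (0 < k < m)%N : hc_vertex_spec k
| HcVertexM : hc_vertex_spec m
| HcVertexCyc2 k of (0 < k < n)%N : hc_vertex_spec (m + k)
| HcVertexPath k of (0 < k < l)%N : hc_vertex_spec (m + n + k - 1).

Lemma hc_vertexP i : (i < N)%N -> hc_vertex_spec i.
Proof.
move=> h; case: (posnP i) => [->|i0]; first by constructor.
case: (ltngtP i m) => [im|im|->]; [|case: (ltnP i (m + n)) => imn|by constructor].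
- by constructor; rewrite i0.
- by rewrite -(subnKC (ltnW im)); constructor; lia.
have -> : i = (m + n + (i.+1 - (m + n)) - 1)%N by lia.
by constructor; lia.
Qed.

End Graph.

Lemma det_prod_pivots (R : comNzRingType) (N : nat) (A U : 'M[R]_N) (c : 'I_N -> R) :
  (forall i j : 'I_N, (i < j)%N -> U i j = 0) -> (forall i, U i i = 1) ->
  (forall i j : 'I_N, (j < i)%N -> (A *m U) i j = 0) ->
  (forall i, (A *m U) i i = c i) -> \det A = \prod_(i < N) c i.
Proof.
move=> U0 U1 AU0 AUc.
have detU : \det U = 1.
  by rewrite det_trig ?big1 //; apply/is_trig_mxP => i j; exact: U0.
(* [A *m U] is upper triangular while [det_trig] is about lower triangular matrices, hence the
   transpose. *)
have := det_mulmx A U; rewrite detU mulr1 => <-; rewrite -det_tr.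
have trigAU : is_trig_mx (A *m U)^T.
  by apply/is_trig_mxP => i j ij; rewrite mxE AU0.
by rewrite (det_trig trigAU); apply: eq_bigr => i _; rewrite mxE AUc.
Qed.

(** * The recurrence along a segment, its explicit solutions and their pivots *)

Section Elimination.
Variables (F : fieldType) (u : F).
Hypothesis u0 : u != 0.

Definition harm (x y : F) (j : nat) : F := x * u ^+ j + y * u ^- j.

(** The row of the matrix at a vertex of degree 2, read along its segment; at [j = 0] the
    predecessor degenerates to 0, so positivity is assumed wherever the recurrence is used. *)
Definition second_diff (f : nat -> F) (j : nat) : F :=
  (1 + u ^+ 2) * f j - u * (f j.-1 + f j.+1).

Lemma second_diff_harm (f : nat -> F) (x y : F) (j : nat) :
  f =1 harm x y -> (0 < j)%N -> second_diff f j = 0.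
Proof.
case: j => // j fE _; rewrite /second_diff !fE /harm /= !exprS.
have := expf_neq0 j u0; move: (u ^+ j) => w w0; field.
by rewrite u0 w0.
Qed.

(** Cutting off below [K] makes a column lower triangular; beyond [K] the recurrence is unaffected,
    and its defect at [K] is the pivot. *)
Definition trunc (K : nat) (f : nat -> F) (j : nat) : F :=
  if (j < K)%N then 0 else f j.

Lemma second_diff_trunc_gt (K j : nat) (f : nat -> F) :
  (K < j)%N -> second_diff (trunc K f) j = second_diff f j.
Proof.
move=> h; rewrite /second_diff /trunc !ifF //; lia.
Qed.

Lemma second_diff_trunc (K : nat) (f : nat -> F) : (0 < K)%N ->
  second_diff (trunc K f) K = (1 + u ^+ 2) * f K - u * f K.+1.
Proof.
move=> h; rewrite /second_diff /trunc ltnn ifT ?ifF ?add0r //; lia.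
Qed.

(* The solution of the recurrence with value 1 at K and 0 at L. *)
Definition dir (L K j : nat) : F :=
  (u ^+ j / u ^+ L - u ^+ L / u ^+ j) / (u ^+ K / u ^+ L - u ^+ L / u ^+ K).

(* The solution with value 0 at 0 and 1 at L. *)
Definition rdir (L j : nat) : F := (u ^+ j - u ^- j) / (u ^+ L - u ^- L).

(* The solution with value 1 at both 0 and L. *)
Definition cyc_harm (L j : nat) : F := (u ^+ j + u ^+ L / u ^+ j) / (1 + u ^+ L).

Definition pivot (J : nat) : F := (1 - u ^+ (2 * J.+1)) / (1 - u ^+ (2 * J)).

Lemma dir_harm L K : exists x y, dir L K =1 harm x y.
Proof.
rewrite /dir; move: (_ / _ - _) => w.
exists (u ^- L / w), (- u ^+ L / w) => j; rewrite /harm; ring.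
Qed.

Lemma rdir_harm L : exists x y, rdir L =1 harm x y.
Proof.
rewrite /rdir; exists (u ^+ L - u ^- L)^-1, (- (u ^+ L - u ^- L)^-1) => j.
rewrite /harm; ring.
Qed.

Lemma cyc_harm_harm L : exists x y, cyc_harm L =1 harm x y.
Proof.
rewrite /cyc_harm; exists (1 + u ^+ L)^-1, (u ^+ L / (1 + u ^+ L)) => j.
rewrite /harm; ring.
Qed.

Lemma dir_end L K : dir L K L = 0.
Proof. by rewrite /dir subrr mul0r. Qed.

Lemma rdir0 L : rdir L 0 = 0.
Proof. by rewrite /rdir expr0 invr1 subrr mul0r. Qed.

Lemma pow_pred j : (0 < j)%N -> u ^+ j.-1 = u ^+ j / u.
Proof. by case: j => // j _; rewrite exprS mulrAC divff // mul1r. Qed.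

Hypothesis root1 : forall k, (0 < k)%N -> 1 - u ^+ k != 0.

Lemma pow_sub_neq0 (J : nat) : (0 < J)%N -> 1 - u ^+ J * u ^+ J != 0.
Proof. by move=> h; rewrite -exprD root1 //; lia. Qed.

Lemma dir_start L K : (K < L)%N -> dir L K K = 1.
Proof.
move=> h; rewrite /dir divff //.
(* Multiplied by [u ^+ (L - K)], the denominator of [dir] becomes [1 - u ^+ (2 * (L - K))], which is
   nonzero. *)
have -> : L = (K + (L - K))%N by lia.
have := pow_sub_neq0 (L - K); rewrite subn_gt0 => /(_ h).
rewrite exprD; have := expf_neq0 K u0; have := expf_neq0 (L - K) u0.
move: (u ^+ K) (u ^+ (L - K)) => x y y0 x0; apply: contraNN => /eqP e; apply/eqP.
have -> : 1 - y * y = (x / (x * y) - x * y / x) * y by field; rewrite x0 y0.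
by rewrite e mul0r.
Qed.

Lemma rdir_end L : (0 < L)%N -> rdir L L = 1.
Proof.
move=> h; rewrite /rdir divff //.
have := pow_sub_neq0 _ h; have := expf_neq0 L u0.
move: (u ^+ L) => y y0; apply: contraNN => /eqP e; apply/eqP.
have -> : 1 - y * y = - (y - y^-1) * y by field.
by rewrite e oppr0 mul0r.
Qed.

Lemma dir_pivot L K : (K < L)%N ->
  (1 + u ^+ 2) * dir L K K - u * dir L K K.+1 = pivot (L - K).
Proof.
move=> h; rewrite dir_start // /dir /pivot.
(* With [L] split this way the powers of [u] at [K] cancel and only the distance [L - K] remains. *)
have {1 2 3 4}-> : L = (K + (L - K))%N by lia.
have := pow_sub_neq0 (L - K); rewrite subn_gt0 => /(_ h).
rewrite !mul2n -!addnn !exprD !exprS; have := expf_neq0 K u0; have := expf_neq0 (L - K) u0.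
move: (u ^+ K) (u ^+ (L - K)) => x y y0 x0 xy; field.
by rewrite x0 y0 u0 xy.
Qed.

(** Each numerator cancels the denominator of the preceding factor. Positions 1 to [L - 1] are the
    vertices of degree 2 of a segment of length [L]. *)
Lemma prod_pivot L : (0 < L)%N ->
  \prod_(1 <= i < L) pivot (L - i) = (1 - u ^+ (2 * L)) / (1 - u ^+ 2).
Proof.
elim: L => // -[_ _|L IH _]; first by rewrite big_geq // muln1 divff // root1.
rewrite big_ltn // big_add1 /=.
under eq_bigr do rewrite subSS.
by rewrite IH // subSS subn0 /pivot mulrA divfK // root1.
Qed.


Definition ihara_mx (N : nat) (adj : rel 'I_N) : 'M[F]_N :=
  \matrix_(i, j) ((i == j)%:R - (adj i j)%:R * u
    + (i == j)%:R * ((gdeg adj i)%:R - 1) * u ^+ 2).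

(** * Rows of the handcuff matrix acting on functions glued from three segments *)

Section Handcuff.
Variables (m n l : nat).
Hypotheses (hm : (2 < m)%N) (hn : (2 < n)%N) (hl : (0 < l)%N).
Local Notation N := (m + n + l - 1)%N.

Definition hc_lap (v : nat -> F) (i : nat) : F :=
  (1 + ((size (hc_nbrs m n l i))%:R - 1) * u ^+ 2) * v i
  - u * \sum_(j <- hc_nbrs m n l i) v j.

(* f1 and f2 are indexed by the position along the two cycles, f3 by the
   position along the path from 0 to m; both ends of the path lie on cycles. *)
Definition glue (f1 f2 f3 : nat -> F) (i : nat) : F :=
  if (i < m)%N then f1 i else if (i < m + n)%N then f2 (i - m)%N
  else f3 (i.+1 - (m + n))%N.

Section Glue.
Variables f1 f2 f3 : nat -> F.
Hypotheses (f1m : f1 m = f1 0) (f2n : f2 n = f2 0).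
Hypotheses (f30 : f3 0 = f1 0) (f3l : f3 l = f2 0).
Local Notation v := (glue f1 f2 f3).

(** Position [m] wraps around to vertex 0, where [f1m] supplies the value; a row next to the wrap
    needs no separate treatment. *)
Lemma glue_cyc1 k : (k <= m)%N -> v (cycv 0 m k) = f1 k.
Proof.
rewrite /glue /cycv => h; case: (k =P m) => [->|h']; first by rewrite ifT ?f1m //; lia.
by rewrite ifT // add0n; lia.
Qed.

Lemma glue_cyc2 k : (k <= n)%N -> v (cycv m n k) = f2 k.
Proof.
rewrite /glue /cycv => h; case: (k =P n) => [->|h'] /=.
  by rewrite ltnn ifT ?subnn ?f2n //; lia.
by rewrite ifF ?ifT ?addKn //; lia.
Qed.

(** Both ends of the path are stored on the cycles; [f30] and [f3l] make the pieces agree there. *)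
Lemma glue_path k : (k <= l)%N -> v (hc_pathv m n l k) = f3 k.
Proof.
rewrite /glue /hc_pathv => h; case: (k =P 0)%N => [->|h']; first by rewrite ifT ?f30 //; lia.
case: (k =P l) => [->|h'']; first by rewrite ltnn ifT ?subnn ?f3l //; lia.
by rewrite !ifF; try lia; congr f3; lia.
Qed.

Lemma cycv_small s L k : (k < L)%N -> cycv s L k = (s + k)%N.
Proof. by rewrite /cycv; case: eqP; lia. Qed.

Lemma hc_lap_cyc1 k : (0 < k < m)%N -> hc_lap v k = second_diff f1 k.
Proof.
move=> h; rewrite /hc_lap hc_nbrs_cyc1 // !big_cons big_nil addr0 /=.
rewrite glue_cyc1; last by lia.
have e j : (j < m)%N -> v j = f1 j.
  by move=> hj; rewrite -(glue_cyc1 j) ?cycv_small //; lia.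
by rewrite !e /second_diff; try lia; ring.
Qed.

Lemma hc_lap_cyc2 k : (0 < k < n)%N -> hc_lap v (m + k) = second_diff f2 k.
Proof.
move=> h; rewrite /hc_lap hc_nbrs_cyc2 // !big_cons big_nil addr0 /=.
rewrite glue_cyc2; last by lia.
have e j : (j < n)%N -> v (m + j)%N = f2 j.
  by move=> hj; rewrite -(glue_cyc2 j) ?cycv_small //; lia.
by rewrite !e /second_diff; try lia; ring.
Qed.

Lemma hc_lap_path k : (0 < k < l)%N ->
  hc_lap v (m + n + k - 1) = second_diff f3 k.
Proof.
move=> h; rewrite /hc_lap hc_nbrs_path // !big_cons big_nil addr0 /=.
have -> : (m + n + k - 1)%N = hc_pathv m n l k.
  by rewrite /hc_pathv; case: eqP; [lia | case: eqP; lia].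
rewrite !glue_path; try lia.
by rewrite /second_diff; ring.
Qed.

Lemma hc_lap_0 :
  hc_lap v 0 = (1 + 2 * u ^+ 2) * f1 0 - u * (f1 1 + f1 m.-1 + f3 1).
Proof.
rewrite /hc_lap /hc_nbrs eqxx !big_cons big_nil addr0 /= glue_path //.
have e j : (j < m)%N -> v j = f1 j.
  by move=> hj; rewrite -(glue_cyc1 j) ?cycv_small //; lia.
by rewrite !e; try lia; ring.
Qed.

Lemma hc_lap_m :
  hc_lap v m = (1 + 2 * u ^+ 2) * f2 0 - u * (f2 1 + f2 n.-1 + f3 l.-1).
Proof.
rewrite /hc_lap /hc_nbrs ltnn eqxx ifF; last by lia.
rewrite !big_cons big_nil addr0 /= glue_path; last by lia.
have e j : (j < n)%N -> v (m + j)%N = f2 j.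
  by move=> hj; rewrite -(glue_cyc2 j) ?cycv_small //; lia.
have -> : m.+1 = (m + 1)%N by lia.
have -> : (m + n).-1 = (m + n.-1)%N by lia.
by rewrite -{1}(addn0 m) !e; try lia; ring.
Qed.

End Glue.

(** * Columns of the multiplier, pivots at the vertices of degree 3, and the determinant *)

Hypothesis root_neg1 : forall k, (0 < k)%N -> 1 + u ^+ k != 0.

Definition pivot_m : F := (1 - u ^+ 2) *
  ((1 - u ^+ l * u ^+ l)^-1 - 2 * u ^+ n / (1 + u ^+ n)).

(* The value at vertex m of column 0, determined by the vanishing of row m. *)
Definition weight_m : F :=
  u ^+ l * (1 - u ^+ 2) / (1 - u ^+ l * u ^+ l) / pivot_m.

(** The analogue of [pivot_m] with the other cycle; the last term comes from the value [weight_m]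
    that column 0 takes at the far end of the path. *)
Definition pivot_0 : F := (1 - u ^+ 2) *
  ((1 - u ^+ l * u ^+ l)^-1 - 2 * u ^+ m / (1 + u ^+ m)
   - weight_m * u ^+ l / (1 - u ^+ l * u ^+ l)).

Hypothesis pivot_num0 : 1 + u ^+ n - 2 * u ^+ n * (1 - u ^+ l * u ^+ l) != 0.

Lemma pivot_m0 : pivot_m != 0.
Proof.
have hn0 : (0 < n)%N by lia.
have := pow_sub_neq0 _ hl; have := root_neg1 _ hn0; rewrite /pivot_m.
move: (u ^+ n) (u ^+ l) pivot_num0 => b c num0 b1 c1.
rewrite mulf_neq0 ?root1 //.
(* Over a common denominator the numerator is the quantity assumed nonzero in [pivot_num0]. *)
rewrite (_ : _^-1 - _ = (1 + b - 2 * b * (1 - c * c)) / ((1 - c * c) * (1 + b))).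
  by rewrite mulf_neq0 ?invr_eq0 // mulf_neq0.
by field; rewrite c1 b1.
Qed.

(** A column at a vertex of degree 2 lives on its own segment and vanishes at the far end. Column
    [m] spreads over the second cycle and the path, vanishing at vertex 0; column 0 spreads over the
    whole graph. *)
Definition hc_col (k : nat) : nat -> F :=
  if k == 0%N then glue (cyc_harm m) (fun j => weight_m * cyc_harm n j)
                     (fun j => dir l 0 j + weight_m * rdir l j)
  else if (k < m)%N then glue (trunc k (dir m k)) (fun=> 0) (fun=> 0)
  else if k == m then glue (fun=> 0) (cyc_harm n) (rdir l)
  else if (k < m + n)%N then
    glue (fun=> 0) (trunc (k - m) (dir n (k - m))) (fun=> 0)
  else let K := (k.+1 - (m + n))%N in
    glue (fun=> 0) (fun=> 0) (trunc K (dir l K)).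

(** On the path, [N - k] is the distance to vertex [m]: position [K] has number [m + n + K - 1]. *)
Definition hc_pivot (k : nat) : F :=
  if k == 0%N then pivot_0 else if (k < m)%N then pivot (m - k)
  else if k == m then pivot_m
  else if (k < m + n)%N then pivot (m + n - k) else pivot (N - k).

Lemma cyc_harm0 L : (0 < L)%N -> cyc_harm L 0 = 1.
Proof. by move=> h; rewrite /cyc_harm expr0 divr1 divff ?root_neg1. Qed.

Lemma cyc_harm_end L : (0 < L)%N -> cyc_harm L L = 1.
Proof.
by move=> h; rewrite /cyc_harm divff ?expf_neq0 // addrC divff ?root_neg1.
Qed.

Lemma dir_l0_l1 : u * dir l 0 l.-1 = u ^+ l * (1 - u ^+ 2) / (1 - u ^+ l * u ^+ l).
Proof.
rewrite /dir pow_pred // expr0.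
have := pow_sub_neq0 _ hl; have := expf_neq0 l u0; move: (u ^+ l) => c c0 c1.
by field; rewrite oner_eq0 c0 u0 c1.
Qed.

Lemma pivot_mE : (1 + 2 * u ^+ 2) * cyc_harm n 0
  - u * (cyc_harm n 1 + cyc_harm n n.-1 + rdir l l.-1) = pivot_m.
Proof.
have hn0 : (0 < n)%N by lia.
rewrite cyc_harm0 // /cyc_harm /rdir !pow_pred // /pivot_m expr1.
have := pow_sub_neq0 _ hl; have := root_neg1 _ hn0.
have := expf_neq0 l u0; have := expf_neq0 n u0.
move: (u ^+ l) (u ^+ n) => c b b0 c0 b1 c1.
(* The denominator of [rdir] yields this factor, opposite in sign to the one already known
   nonzero. *)
have c2 : c * c - 1 != 0 by rewrite -oppr_eq0 opprB.
by field; rewrite ?oner_eq0 ?c0 ?u0 ?c1 ?c2 ?b0 ?b1.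
Qed.

Lemma pivot_0E : (1 + 2 * u ^+ 2) * cyc_harm m 0
  - u * (cyc_harm m 1 + cyc_harm m m.-1 + (dir l 0 1 + weight_m * rdir l 1))
  = pivot_0.
Proof.
have hm0 : (0 < m)%N by lia.
rewrite cyc_harm0 // /cyc_harm /rdir /dir !pow_pred // /pivot_0 expr1 expr0.
have := pow_sub_neq0 _ hl; have := root_neg1 _ hm0.
have := expf_neq0 l u0; have := expf_neq0 m u0.
move: (u ^+ l) (u ^+ m) weight_m => c b w b0 c0 b1 c1.
have c2 : c * c - 1 != 0 by rewrite -oppr_eq0 opprB.
by field; rewrite ?oner_eq0 ?c0 ?u0 ?c1 ?c2 ?b0 ?b1.
Qed.

Lemma second_diff_cst0 k : second_diff (fun=> 0) k = 0.
Proof. by rewrite /second_diff addr0 !mulr0 subr0. Qed.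

Lemma trunc_dir0 L k : (0 < k)%N -> trunc k (dir L k) 0 = 0.
Proof. by rewrite /trunc => ->. Qed.

Lemma trunc_dir_end L k : trunc k (dir L k) L = 0.
Proof. by rewrite /trunc dir_end if_same. Qed.

Lemma second_diff_trunc_dir L k i : (0 < k < L)%N -> (k <= i)%N ->
  second_diff (trunc k (dir L k)) i = if i == k then pivot (L - k) else 0.
Proof.
move=> /andP[k0 kL] ki; case: eqP => [->|ik].
  by rewrite second_diff_trunc // dir_pivot.
rewrite second_diff_trunc_gt; last by lia.
by have [x [y e]] := dir_harm L k; apply: second_diff_harm e _; lia.
Qed.

(** Below the diagonal, a row at a vertex of degree 2 sees a solution of the recurrence or zero. Row
    [m] sees only zeros, except in column 0, where [weight_m] is chosen to cancel it. *)
Lemma hc_lap_col (k i : nat) : (k < N)%N -> (i < N)%N -> (k <= i)%N ->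
  hc_lap (hc_col k) i = if i == k then hc_pivot k else 0.
Proof.
move=> hk hi; rewrite /hc_col /hc_pivot.
have hn0 : (0 < n)%N by lia.
have hm0 : (0 < m)%N by lia.
case: (hc_vertexP _ _ _ hm hn hl k hk) => {k hk} [|k hk||k hk|k hk].
- move=> _ /=; set f1 := cyc_harm m; set f2 := (fun j => _ * _); set f3 := (fun j => _ + _).
  (* These four facts are the gluing conditions, needed as side conditions of the row lemmas
     below. *)
  have f1m : f1 m = f1 0 by rewrite /f1 cyc_harm_end // cyc_harm0.
  have f2n : f2 n = f2 0 by rewrite /f2 cyc_harm_end // cyc_harm0.
  have f30 : f3 0 = f1 0 by rewrite /f3 /f1 cyc_harm0 // rdir0 mulr0 addr0 dir_start.
  have f3l : f3 l = f2 0 by rewrite /f3 /f2 cyc_harm0 // rdir_end // dir_end add0r.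
  have [x [y e1]] := cyc_harm_harm m; have [x2 [y2 e2]] := cyc_harm_harm n.
  have [x3 [y3 e3]] := dir_harm l 0; have [x4 [y4 e4]] := rdir_harm l.
  case: (hc_vertexP _ _ _ hm hn hl i hi) => {i hi} [|k hk||k hk|k hk].
  + by rewrite hc_lap_0 // -pivot_0E.
  + rewrite hc_lap_cyc1 // ifF; last by lia.
    by apply: second_diff_harm e1 _; lia.
  + rewrite hc_lap_m // ifF; last by lia.
    (* On the second cycle and the path, column 0 is [weight_m] times column [m], plus [dir l 0] on
       the path, which vanishes at [m]. *)
    transitivity (weight_m * pivot_m - u * dir l 0 l.-1).
      by rewrite -pivot_mE /f2 /f3; ring.
    by rewrite dir_l0_l1 /weight_m divfK ?subrr ?pivot_m0.
  + rewrite hc_lap_cyc2 // ifF; last by lia.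
    apply: (second_diff_harm _ (weight_m * x2) (weight_m * y2)); last by lia.
    by move=> j; rewrite /f2 e2 /harm; ring.
  rewrite hc_lap_path // ifF; last by lia.
  apply: (second_diff_harm _ (x3 + weight_m * x4) (y3 + weight_m * y4)); last by lia.
  by move=> j; rewrite /f3 e3 e4 /harm; ring.
- move=> ki; rewrite (_ : (k == 0)%N = false); last by lia.
  rewrite (_ : (k < m)%N = true) /=; last by lia.
  set f1 := trunc _ _.
  have f1m : f1 m = f1 0 by rewrite /f1 trunc_dir_end trunc_dir0 //; lia.
  have f10 : 0 = f1 0 by rewrite /f1 trunc_dir0 //; lia.
  case: (hc_vertexP _ _ _ hm hn hl i hi) ki => {i hi} [|i hi||i hi|i hi] ki.
  + lia.
  + by rewrite hc_lap_cyc1 // second_diff_trunc_dir.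
  + rewrite hc_lap_m // ifF; last by lia.
    by rewrite !addr0 !mulr0 subr0.
  + rewrite hc_lap_cyc2 // ifF; last by lia.
    exact: second_diff_cst0.
  rewrite hc_lap_path // ifF; last by lia.
  exact: second_diff_cst0.
- rewrite (_ : (m == 0)%N = false); last by lia.
  rewrite ltnn eqxx => ki.
  set f2 := cyc_harm n; set f3 := rdir l.
  have f2n : f2 n = f2 0 by rewrite /f2 cyc_harm_end // cyc_harm0.
  have f30 : f3 0 = 0 by rewrite /f3 rdir0.
  have f3l : f3 l = f2 0 by rewrite /f3 /f2 cyc_harm0 // rdir_end.
  have [x2 [y2 e2]] := cyc_harm_harm n; have [x4 [y4 e4]] := rdir_harm l.
  case: (hc_vertexP _ _ _ hm hn hl i hi) ki => {i hi} [|i hi||i hi|i hi] ki; try lia.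
  + by rewrite hc_lap_m // eqxx -pivot_mE.
  + rewrite hc_lap_cyc2 // ifF; last by lia.
    by apply: second_diff_harm e2 _; lia.
  rewrite hc_lap_path // ifF; last by lia.
  by apply: second_diff_harm e4 _; lia.
- move=> ki; rewrite (_ : (m + k == 0)%N = false); last by lia.
  rewrite (_ : (m + k < m)%N = false); last by lia.
  rewrite (_ : (m + k == m)%N = false); last by lia.
  rewrite (_ : (m + k < m + n)%N = true); last by lia.
  rewrite addKn subnDl; set f2 := trunc _ _.
  have f2n : f2 n = f2 0 by rewrite /f2 trunc_dir_end trunc_dir0 //; lia.
  have f20 : 0 = f2 0 by rewrite /f2 trunc_dir0 //; lia.
  case: (hc_vertexP _ _ _ hm hn hl i hi) ki => {i hi} [|i hi||i hi|i hi] ki; try lia.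
  + rewrite hc_lap_cyc2 // second_diff_trunc_dir // ?eqn_add2l //; lia.
  rewrite hc_lap_path // ifF; last by lia.
  exact: second_diff_cst0.
move=> ki; rewrite (_ : (m + n + k - 1 == 0)%N = false); last by lia.
rewrite (_ : (m + n + k - 1 < m)%N = false); last by lia.
rewrite (_ : (m + n + k - 1 == m)%N = false); last by lia.
rewrite (_ : (m + n + k - 1 < m + n)%N = false); last by lia.
rewrite (_ : (m + n + k - 1).+1 - (m + n) = k)%N /=; last by lia.
rewrite (_ : (m + n + l - 1 - (m + n + k - 1)) = l - k)%N /=; last by lia.
set f3 := trunc _ _.
have f30 : f3 0 = 0 by rewrite /f3 trunc_dir0 //; lia.
have f3l : f3 l = 0 by rewrite /f3 trunc_dir_end.
case: (hc_vertexP _ _ _ hm hn hl i hi) ki => {i hi} [|i hi||i hi|i hi] ki; try lia.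
rewrite hc_lap_path // second_diff_trunc_dir //; last by lia.
by rewrite (_ : (m + n + i - 1 == m + n + k - 1)%N = (i == k)) //; lia.
Qed.

Lemma hc_col_lt (k i : nat) : (k < N)%N -> (i < k)%N -> hc_col k i = 0.
Proof.
move=> hk; rewrite /hc_col.
case: (hc_vertexP _ _ _ hm hn hl k hk) => {k hk} [|k hk||k hk|k hk] ik //.
- rewrite ifF; last by lia.
  rewrite ifT; last by lia.
  by rewrite /glue /trunc ik ifT //; lia.
- rewrite ifF; last by lia.
  by rewrite ltnn eqxx /glue ik.
- do 3 (rewrite ifF; last by lia).
  rewrite ifT; last by lia.
  rewrite /glue /trunc; case: ltnP => // mi; rewrite ifT; last by lia.
  by rewrite ifT //; lia.
do 4 (rewrite ifF; last by lia).
rewrite /glue /trunc; case: ltnP => // mi; case: ltnP => // mni.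
by rewrite ifT //; lia.
Qed.

Lemma hc_col_diag (k : nat) : (k < N)%N -> hc_col k k = 1.
Proof.
move=> hk; rewrite /hc_col.
case: (hc_vertexP _ _ _ hm hn hl k hk) => {k hk} [|k hk||k hk|k hk] //=.
- by rewrite /glue ifT ?cyc_harm0 //; lia.
- rewrite ifF; last by lia.
  rewrite ifT; last by lia.
  by rewrite /glue /trunc ltnn ifT ?dir_start //; lia.
- rewrite ifF; last by lia.
  by rewrite ltnn eqxx /glue ltnn ifT ?subnn ?cyc_harm0 //; lia.
- do 3 (rewrite ifF; last by lia).
  rewrite ifT; last by lia.
  rewrite /glue /trunc addKn ltnn ifF; last by lia.
  by rewrite ifT ?dir_start //; lia.
do 4 (rewrite ifF; last by lia).
rewrite /glue /trunc ltnn ifF; last by lia.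
rewrite ifF; last by lia.
by rewrite dir_start //; lia.
Qed.

Lemma ihara_mx_mul_col (v : 'I_N -> nat -> F) (i j : 'I_N) :
  (ihara_mx _ (handcuff_adj m n l) *m \matrix_(i, j) v j i) i j
  = hc_lap (v j) i.
Proof.
rewrite mxE; under eq_bigr => k _ do rewrite !mxE.
rewrite /hc_lap -hc_adj_sum // -hc_gdeg // mulr_sumr.
(* The diagonal term becomes a sum against a Kronecker delta, so that both sides compare term by
   term. *)
rewrite (_ : (_ * v j i) = \sum_(k < N) (i == k)%:R *
    ((1 + ((gdeg (handcuff_adj m n l) i)%:R - 1) * u ^+ 2) * v j k)).
  by rewrite -sumrB; apply: eq_bigr => k _; ring.
rewrite (bigD1 i) //= eqxx mul1r big1 ?addr0 // => k ki.
by rewrite eq_sym (negPf ki) mul0r.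
Qed.

Lemma prod_hc_pivot : \prod_(i < N) hc_pivot i =
  pivot_0 * ((1 - u ^+ (2 * m)) / (1 - u ^+ 2)) *
  (pivot_m * ((1 - u ^+ (2 * n)) / (1 - u ^+ 2))) *
  ((1 - u ^+ (2 * l)) / (1 - u ^+ 2)).
Proof.
have E1 : \prod_(0 <= i < m) hc_pivot i = pivot_0 * \prod_(1 <= i < m) pivot (m - i).
  rewrite big_ltn; last by lia.
  congr (_ * _); apply: eq_big_nat => i hi; rewrite /hc_pivot ifF; last by lia.
  by rewrite ifT //; lia.
have E2 : \prod_(m <= i < m + n) hc_pivot i = pivot_m * \prod_(1 <= i < n) pivot (n - i).
  rewrite big_ltn; last by lia.
  rewrite -{1}(add1n m) big_addn addKn; congr (_ * _).
    by rewrite /hc_pivot ltnn eqxx ifF //; lia.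
  apply: eq_big_nat => i hi; rewrite /hc_pivot.
  do 3 (rewrite ifF; last by lia).
  by rewrite ifT; [congr pivot; lia | lia].
have E3 : \prod_(m + n <= i < N) hc_pivot i = \prod_(1 <= i < l) pivot (l - i).
  (* Shifting by [m + n - 1] turns vertex numbers into path positions, which start at 1. *)
  rewrite (_ : (m + n)%N = (1 + (m + n - 1))%N); last by lia.
  rewrite big_addn (_ : (1 + (m + n - 1) + l - 1 - (m + n - 1))%N = l); last by lia.
  apply: eq_big_nat => i hi; rewrite /hc_pivot.
  by do 4 (rewrite ifF; last by lia); congr pivot; lia.
rewrite -(big_mkord xpredT) (@big_cat_nat _ _ _ m) /=; try lia.
rewrite (@big_cat_nat _ _ _ (m + n) m) /=; try lia.
by rewrite E1 E2 E3 !prod_pivot ?mulrA //; lia.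
Qed.

Lemma det_ihara_mx : \det (ihara_mx _ (handcuff_adj m n l)) =
  \prod_(i < N) hc_pivot i.
Proof.
apply: (det_prod_pivots _ _ _ (\matrix_(i, j) hc_col j i)).
- by move=> i j ij; rewrite mxE hc_col_lt.
- by move=> i; rewrite mxE hc_col_diag.
- move=> i j ji; rewrite (ihara_mx_mul_col (fun j => hc_col j)).
  by rewrite hc_lap_col // ?ifF //; lia.
by move=> i; rewrite (ihara_mx_mul_col (fun j => hc_col j)) hc_lap_col ?eqxx.
Qed.

(** The three telescoped products leave [(1 - u ^+ 2) ^- 3]; the two special pivots supply two
    factors [1 - u ^+ 2] and the prefactor supplies the third. The factor [pivot_m] clears the
    denominator of [weight_m] inside [pivot_0]. *)
Lemma handcuff_det : (1 - u ^+ 2) * \det (ihara_mx _ (handcuff_adj m n l)) =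
  (1 - u ^+ m) * (1 - u ^+ n) *
  ((1 - u ^+ m) * (1 - u ^+ n) - 4 * u ^+ m * u ^+ n * (u ^+ l * u ^+ l)).
Proof.
rewrite det_ihara_mx prod_hc_pivot /pivot_0 /weight_m.
rewrite /pivot_m !mul2n -!addnn !exprD.
have hn0 : (0 < n)%N by lia.
have hm0 : (0 < m)%N by lia.
have := pow_sub_neq0 _ hl; have := root_neg1 _ hm0; have := root_neg1 _ hn0.
have := root1 2 isT; move: pivot_num0.
move: (u ^+ m) (u ^+ n) (u ^+ l) => a b c num0 s1 b1 a1 c1.
by field; rewrite ?mulNr s1 b1 c1 a1 ?num0.
Qed.

End Handcuff.
End Elimination.

(** * Transfer to integer polynomials through their fraction field *)

Lemma tofrac_neq0 (p : {poly int}) : p.[0] = 1 -> FracField.tofrac p != 0.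
Proof.
by move=> p1; rewrite tofrac_eq0; apply: contra_eq_neq p1 => ->; rewrite horner0.
Qed.

Lemma map_ihara_mx (N : nat) (adj : rel 'I_N) :
  map_mx (@FracField.tofrac {poly int}) (\matrix_(i, j)
      (((i == j)%:R)%:P - (adjmx adj i j)%:P * 'X + (Qmx adj i j)%:P * 'X^2)) =
  ihara_mx _ (FracField.tofrac 'X) _ adj.
Proof.
apply/matrixP => i j; rewrite !mxE.
rewrite tofracD tofracB 2!tofracM tofracXn polyCM polyCB !rmorph_nat polyC1.
by rewrite tofracM tofracB !rmorph_nat tofrac1.
Qed.

Theorem mainTheorem7 (m n l : nat) (hm : (2 < m)%N) (hn : (2 < n)%N) (hl : (0 < l)%N) :
  ihara_recip (handcuff_adj m n l) =
    - 4 * 'X^(2 * m + 2 * n + 2 * l)%N + 'X^(2 * m + 2 * n)%N + 4 * 'X^(2 * m + n + 2 * l)%N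
    + 4 * 'X^(m + 2 * n + 2 * l)%N - 2 * 'X^(2 * m + n)%N - 2 * 'X^(m + 2 * n)%N
    - 4 * 'X^(m + n + 2 * l)%N + 4 * 'X^(m + n)%N + 'X^(2 * n)%N + 'X^(2 * m)%N
    - 2 * 'X^n - 2 * 'X^m + 1.
Proof.
(* The expanded right-hand side is replaced by its factored form, the one elimination produces. *)
transitivity ((1 - 'X^m) * (1 - 'X^n) * ((1 - 'X^m) * (1 - 'X^n)
    - 4 * 'X^m * 'X^n * ('X^l * 'X^l)) : {poly int}); last first.
  by rewrite !mul2n -!addnn !exprD; ring.
have X0 k : (0 < k)%N -> ('X^k : {poly int}).[0] = 0.
  by case: k => // k _; rewrite hornerXn exprS mul0r.
have u0 : FracField.tofrac ('X : {poly int}) != 0 by rewrite tofrac_eq0 polyX_eq0.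
have root1 k : (0 < k)%N -> 1 - FracField.tofrac ('X : {poly int}) ^+ k != 0.
  move=> k0; rewrite -tofracXn -tofrac1 -tofracB tofrac_neq0 //.
  by rewrite hornerD hornerN hornerC X0 ?subr0.
have root_neg1 k : (0 < k)%N -> 1 + FracField.tofrac ('X : {poly int}) ^+ k != 0.
  move=> k0; rewrite -tofracXn -tofrac1 -tofracD tofrac_neq0 //.
  by rewrite hornerD hornerC X0 ?addr0.
(* Like the two previous conditions, this one holds because the polynomial has constant term 1. *)
have num0 : let u := FracField.tofrac ('X : {poly int}) in
    1 + u ^+ n - 2 * u ^+ n * (1 - u ^+ l * u ^+ l) != 0.
  rewrite /= -!tofracXn -[X in _ - X * _ * _](rmorph_nat (@FracField.tofrac {poly int})).
  rewrite -!(tofracM, tofrac1, tofracB, tofracD) tofrac_neq0 //.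
  rewrite !(hornerD, hornerN, hornerM, hornerC).
  by rewrite !X0 ?mulr0 ?mul0r ?addr0 ?subr0 //; lia.
(* The embedding into the fraction field is injective, so the identity may be checked there; rank 2
   makes the exponent of the prefactor 1. *)
apply/eqP; rewrite -tofrac_eq; apply/eqP.
rewrite /ihara_recip hc_grank // expr1 tofracM -det_map_mx map_ihara_mx.
have := handcuff_det _ _ u0 root1 _ _ _ hm hn hl root_neg1 num0.
move: (\det _) => d.
rewrite -[X in _ - X * _ * _ * _](rmorph_nat (@FracField.tofrac {poly int})).
by rewrite -!(tofracXn, tofracM, tofrac1, tofracB).
Qed.
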